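(* Let $r\ge2$ be a fixed integer. For each integer $n\ge1$, let $\mathbf{M}^{(r)}_n$ be a uniformly random $r$-matching on $[rn]$, let $L^{(r)}=\sum_{e\in\mathbf{M}^{(r)}_n}\ell(e)$, and let $\bar L^{(r)}=\frac{L^{(r)}}n$. Then for every $n\ge1$, $$\mathbb{E}\,\bar L^{(r)}=\frac{r(r-1)(rn+1)}{2(r+1)}.$$ Moreover, for every function $\omega$ with $\omega(n)\to\infty$ as $n\to\infty$, $$\lim_{n\to\infty}\mathbb{P}\left(\left|\bar L^{(r)}-\frac{(r-1)r^2n}{2(r+1)}\right|\le\omega(n)\sqrt n\right)=1.$$
   Context: $[m]=\{1,2,\dots,m\}$. An $r$-matching on $[rn]$ is a partition of $[rn]$ into $n$ subsets of size $r$, called edges; a uniformly random $r$-matching is chosen uniformly from all $\frac{(rn)!}{(r!)^n n!}$ of them. The length of an edge $e=\{i_1<i_2<\cdots<i_r\}\subset[rn]$ is defined as $$\ell(e)=(i_2-i_1)+2(i_3-i_2)+\cdots+(r-1)(i_r-i_{r-1})=\sum_{j=1}^{r-1}(i_r-i_j).$$ *)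

(* Defs.v *)
From mathcomp Require Import all_boot all_order all_algebra.
From mathcomp Require Import all_classical all_reals all_analysis.

Set Implicit Arguments.
Unset Strict Implicit.
Unset Printing Implicit Defensive.

Import Order.TTheory GRing.Theory Num.Theory.
Import numFieldNormedType.Exports.

Local Open Scope ring_scope.

(* The set [m] = {1, .., m} is represented by 'I_m, where i : 'I_m stands for
   the integer i.+1. *)

Definition r_matchings (r n : nat) : {set {set {set 'I_(r * n)}}} :=
  [set M : {set {set 'I_(r * n)}} |
    [&& finset.partition M [set: 'I_(r * n)], #|M| == n & [forall e in M, #|e| == r]]]%SET.

(* edge_points e = [:: i_1; ..; i_r] with i_1 < .. < i_r. *)
Definition edge_points (N : nat) (e : {set 'I_N}) : seq nat :=
  sort leq [seq (val i).+1 | i <- enum e].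

(* The truncated subtraction is harmless because edge_points e is increasing.
   Indices are 0-based: i_(j.+1) - i_j is s`_j - s`_(j.-1). *)
Definition edge_length (N : nat) (e : {set 'I_N}) : nat :=
  (let s := edge_points e in
   \sum_(1 <= j < size s) j * (nth 0 s j - nth 0 s j.-1))%N.

Definition total_length (N : nat) (M : {set {set 'I_N}}) : nat :=
  (\sum_(e in M) edge_length e)%N.

Definition mean_length (R : realType) (r n : nat) (M : {set {set 'I_(r * n)}}) : R :=
  (total_length M)%:R / n%:R.

Definition uniform_r_matching (R : realType) (d : measure_display)
    (T : measurableType d) (P : probability T R) (r n : nat)
    (M : T -> {set {set 'I_(r * n)}}) : Prop :=
  forall A : {set {set 'I_(r * n)}},
    measurable [set t | M t = A]%classic /\
    P [set t | M t = A]%classic =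
      (if A \in r_matchings r n then (#|r_matchings r n|%:R)^-1 else 0)%:E.

Lemma size_edge_points (N : nat) (e : {set 'I_N}) : size (edge_points e) = #|e|.
Proof. by rewrite size_sort size_map cardE. Qed.

Lemma edge_points_sorted (N : nat) (e : {set 'I_N}) :
  sorted ltn (edge_points e).
Proof.
rewrite ltn_sorted_uniq_leq sort_uniq sort_sorted ?andbT; last exact: leq_total.
by rewrite map_inj_uniq ?enum_uniq// => i j [] /val_inj.
Qed.

(* The second expression for the length: the sum of the i_r - i_j, j < r. *)
Lemma edge_lengthE (N : nat) (e : {set 'I_N}) :
  (edge_length e = \sum_(0 <= j < #|e|.-1)
     (nth 0 (edge_points e) #|e|.-1 - nth 0 (edge_points e) j))%N.
Proof.
rewrite /edge_length/= size_edge_points.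
have := edge_points_sorted e.
have <- := size_edge_points e.
move: (edge_points e) => s ss.
case E : (size s) => [|k]; first by rewrite !big_geq.
have {E} : (k < size s)%N by rewrite E.
elim: k => [|k IH] ks; first by rewrite !big_geq.
rewrite big_nat_recr//= (IH (ltnW ks)) [RHS]big_nat_recr//=.
have le_nth j : (j <= k)%N -> (nth 0 s j <= nth 0 s k)%N.
  move=> jk; have lts := sorted_ltn_nth ltn_trans 0%N ss.
  case: (ltngtP j k) jk => // [jk _|-> //].
  by apply/ltnW/lts => //; rewrite unfold_in/= ?(ltn_trans jk) ?(ltnW ks).
have lt1 : (nth 0 s k <= nth 0 s k.+1)%N.
  by apply/ltnW/(sorted_ltn_nth ltn_trans 0%N ss) => //;
    rewrite unfold_in/= ?(ltnW ks).
rewrite mulSnr addnA; congr (_ + _)%N.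
rewrite -[in (k * _)%N](subn0 k) -sum_nat_const_nat -big_split/=.
apply: eq_big_nat => j /andP[_ jk].
have lejk := le_nth j (ltnW jk).
by rewrite !subn0 addnC addnBA// subnK.
Qed.

(* Main.v *)
(* Since l(e) = r max(e) - sum(e) (with points numbered from 1), the total
   length is an affine function of the sum over k < N = r n of
   X_k = #{e in M : e is contained in [k]}.  By symmetry under permutations of
   the points, an r-set, or an ordered pair of disjoint r-sets, lies in the
   random matching with a probability which does not depend on the choice of
   the set or pair.  Hence E X_k = n q_k with q_k = C(k,r) / C(N,r), and
   E X_k (X_k - 1) <= n (n - 1) q_k^2, so that Var X_k <= n.  Cauchy-Schwarz
   gives Var (sum_k X_k) <= N^2 n, that is, the mean length has variance at
   most r^4 n, and Chebyshev's inequality concludes. *)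

Require Import Defs.
From mathcomp Require Import all_boot all_order all_algebra all_fingroup.
From mathcomp Require Import all_classical all_reals all_analysis.
From mathcomp Require Import ring lra zify.

Set Implicit Arguments.
Unset Strict Implicit.
Unset Printing Implicit Defensive.

Import Order.TTheory GRing.Theory Num.Theory.
Import numFieldNormedType.Exports.

(** * Permutations carrying one pair of disjoint sets to another *)

Lemma perm_map_uniq (T : finType) (s t : seq T) :
  uniq s -> uniq t -> size s = size t -> exists p : {perm T}, map p s = t.
Proof.
elim: s t => [|x s IH] [|y t] //=; first by exists 1%g.
move=> /andP[xs us] /andP[yt ut] [] /(IH _ us ut)[p pst].
(* The product applies [p] first. The transposition corrects the image of [x] and fixes every point
   of [t], which contains neither [p x] nor [y]. *)
exists (p * tperm (p x) y)%g; rewrite permM tpermL; congr cons.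
rewrite -[RHS]pst; apply/eq_in_map => z zs; rewrite permM tpermD//.
- by apply: contraNneq xs => /perm_inj ->.
- by apply: contraNneq yt => ->; rewrite -pst map_f.
Qed.

Lemma perm_imset_pair (T : finType) (A B A' B' : {set T}) :
  #|A| = #|A'| -> #|B| = #|B'| -> [disjoint A & B] -> [disjoint A' & B'] ->
  exists p : {perm T}, (p @: A = A')%SET /\ (p @: B = B')%SET.
Proof.
move=> cA cB dAB dAB'.
have u (C D : {set T}) : [disjoint C & D] -> uniq (enum C ++ enum D).
  move=> dCD; rewrite cat_uniq !enum_uniq andbT/=; apply/hasPn => x.
  by rewrite /= !mem_enum => xD; rewrite (disjointFl dCD).
have [|p] := perm_map_uniq (u _ _ dAB) (u _ _ dAB').
  by rewrite !size_cat -!cardE cA cB.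
have im (C D : {set T}) : map p (enum C) = enum D -> (p @: C = D)%SET.
  move=> CD; apply/setP => x; rewrite -[RHS]mem_enum -CD.
  by apply/imsetP/mapP => -[y yC ->]; exists y; rewrite ?mem_enum// -mem_enum.
rewrite map_cat => /eqP; rewrite eqseq_cat ?size_map -?cardE//.
by move=> /andP[/eqP pA /eqP pB]; exists p; split; apply: im.
Qed.

(** * Counting the matchings through a given edge or pair of edges *)

Section Matchings.
Variables r n : nat.
Local Notation N := (r * n)%N.
Local Notation RM := (r_matchings r n).

Lemma r_matchings_imset (p : {perm 'I_N}) (M : {set {set 'I_N}}) :
  M \in RM -> [set p @: (e : {set 'I_N}) | e in M]%SET \in RM.
Proof.
rewrite !inE => /and3P[pM /eqP cM /forall_inP rM]; apply/and3P; split.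
- rewrite (_ : [set: 'I_N]%SET = p @: [set: 'I_N])%SET ?imset_partition//;
    first exact: perm_inj.
  apply/setP => x; rewrite inE -[x](permKV p) mem_imset ?inE//.
  exact: perm_inj.
- by rewrite card_imset ?cM//; exact/imset_inj/perm_inj.
- apply/forall_inP => _ /imsetP[e eM ->]; rewrite card_imset ?rM//.
  exact: perm_inj.
Qed.

(** The case [S = S'] is allowed and counts the matchings through a single edge, so one invariance
    lemma serves both the first and the second moment. *)
Definition codegree (S S' : {set 'I_N}) : nat :=
  #|[set M in RM | (S \in M) && (S' \in M)]%SET|.

(** Taking images under a permutation is injective on matchings, which gives one inequality; the
    inverse permutation gives the other. *)
Lemma codegree_imset (p : {perm 'I_N}) (S S' : {set 'I_N}) :
  codegree (p @: S)%SET (p @: S')%SET = codegree S S'.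
Proof.
have le (q : {perm 'I_N}) (A B : {set 'I_N}) :
    (codegree A B <= codegree (q @: A)%SET (q @: B)%SET)%N.
  have iq : injective (fun e : {set 'I_N} => q @: e)%SET.
    exact/imset_inj/perm_inj.
  rewrite /codegree -(card_imset _ (imset_inj iq)).
  apply/subset_leq_card/fintype.subsetP => M' /imsetP[M].
  rewrite inE => /and3P[MRM AM BM] ->.
  by rewrite inE r_matchings_imset//= !mem_imset// AM BM.
apply/eqP; rewrite eqn_leq le andbT.
have K (A : {set 'I_N}) : (p^-1%g @: (p @: A))%SET = A.
  by rewrite -imset_comp -[RHS]imset_id; apply: eq_imset; exact: permK.
by have := le p^-1%g (p @: S)%SET (p @: S')%SET; rewrite !K.
Qed.

Lemma codegree_disjoint (S S' U U' : {set 'I_N}) :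
  #|S| = #|U| -> #|S'| = #|U'| -> [disjoint S & S'] -> [disjoint U & U'] ->
  codegree S S' = codegree U U'.
Proof.
move=> c c' d d'; have [p [<- <-]] := perm_imset_pair c c' d d'.
by rewrite codegree_imset.
Qed.

Lemma codegree_diag (S U : {set 'I_N}) :
  #|S| = #|U| -> codegree S S = codegree U U.
Proof.
move=> c; have [|||p [<- _]] := @perm_imset_pair _ S finset.set0 U finset.set0 c.
- by [].
- by rewrite -finset.setI_eq0 finset.setI0.
- by rewrite -finset.setI_eq0 finset.setI0.
by rewrite codegree_imset.
Qed.

(** For [A] the first k points this is X_k. A general [A] includes the full set, where the value is
    known to be [n]. *)
Definition edges_inside (A : {set 'I_N}) (M : {set {set 'I_N}}) : nat :=
  #|[set e in M | e \subset A]%SET|.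

Lemma r_matchings_card_edge (M : {set {set 'I_N}}) (e : {set 'I_N}) :
  M \in RM -> e \in M -> #|e| = r.
Proof. by rewrite inE => /and3P[_ _ /forall_inP rM] /rM /eqP. Qed.

Lemma r_matchings_disjoint (M : {set {set 'I_N}}) (e e' : {set 'I_N}) :
  M \in RM -> e \in M -> e' \in M -> [disjoint e & e'] = (e != e').
Proof.
rewrite inE => /and3P[/and3P[_ /finset.trivIsetP tM M0] _ _] eM e'M.
apply/idP/idP; last exact: tM.
apply: contraTneq => <-; rewrite -finset.setI_eq0 finset.setIid.
by apply: contraNneq M0 => <-.
Qed.

Lemma edges_inside_setT (M : {set {set 'I_N}}) :
  M \in RM -> edges_inside [set: 'I_N]%SET M = n.
Proof.
rewrite inE => /and3P[_ /eqP Mn _]; rewrite -[RHS]Mn; apply: eq_card => e.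
by rewrite inE finset.subsetT andbT.
Qed.

Lemma edges_insideE (A : {set 'I_N}) (M : {set {set 'I_N}}) : M \in RM ->
  edges_inside A M =
  \sum_(S : {set 'I_N} | (S \subset A) && (#|S| == r)) (S \in M).
Proof.
move=> MRM; rewrite /edges_inside -sum1_card [LHS]big_mkcond [RHS]big_mkcond.
apply: eq_bigr => S _; rewrite inE.
have [SM|] := boolP (S \in M); last by rewrite if_same.
by rewrite (r_matchings_card_edge MRM SM) eqxx andbT.
Qed.

(** Both sides count ordered pairs of distinct edges inside [A]. Such edges are disjoint, so the
    second lies in [A :\: S], and on disjoint pairs of r-sets the codegree is constant. *)
Lemma edges_inside_pairsE (A : {set 'I_N}) (M : {set {set 'I_N}}) : M \in RM ->
  edges_inside A M * (edges_inside A M).-1 =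
  \sum_(S : {set 'I_N} | (S \subset A) && (#|S| == r))
   \sum_(S' : {set 'I_N} | (S' \subset A :\: S)%SET && (#|S'| == r))
     ((S \in M) && (S' \in M)).
Proof.
move=> MRM; rewrite {1}edges_insideE// big_distrl/=.
apply: eq_bigr => S /andP[SA _].
have [SM|_] := boolP (S \in M); last by rewrite mul0n big1.
have -> : (edges_inside A M).-1 = #|[set e in M | e \subset A] :\ S|%SET.
  by rewrite /edges_inside (cardsD1 S) inE SM SA.
rewrite mul1n -sum1_card [LHS]big_mkcond [RHS]big_mkcond.
apply: eq_bigr => S' _ /=; rewrite !inE.
have [S'M|] := boolP (S' \in M); last by rewrite andbF if_same.
rewrite (r_matchings_card_edge MRM S'M) eqxx andbT subsetD disjoint_sym.
by rewrite (r_matchings_disjoint MRM SM S'M) eq_sym andbC.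
Qed.

Lemma sum_matchings_codegree (S S' : {set 'I_N}) :
  \sum_(M in RM) ((S \in M) && (S' \in M) : nat) = codegree S S'.
Proof.
rewrite /codegree -sum1_card [RHS]big_mkcond [LHS]big_mkcond.
by apply: eq_bigr => M _; rewrite inE; case: (M \in RM) => //=; case: (_ && _).
Qed.

Lemma sum_r_subsets_cst (A : {set 'I_N}) (c : nat) :
  \sum_(S : {set 'I_N} | (S \subset A) && (#|S| == r)) c = 'C(#|A|, r) * c.
Proof.
rewrite -cards_draws -sum_nat_const; apply: eq_bigl => S.
by rewrite inE.
Qed.

(** Every r-set lies in the same number [c] of matchings. The full set, inside which every matching
    has [n] edges, determines [c]; cross-multiplying keeps the identity in [nat]. *)
Lemma sum_edges_inside (A : {set 'I_N}) :
  (\sum_(M in RM) edges_inside A M) * 'C(N, r) = 'C(#|A|, r) * (n * #|RM|).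
Proof.
have [c cP] : exists c, forall S : {set 'I_N}, #|S| = r -> codegree S S = c.
  case: (pickP [pred S : {set 'I_N} | #|S| == r]) => [U /eqP Ur|no].
    by exists (codegree U U) => S Sr; apply: codegree_diag; rewrite Sr.
  by exists 0 => S Sr; have /= := no S; rewrite Sr eqxx.
have sumE B : \sum_(M in RM) edges_inside B M = 'C(#|B|, r) * c.
  rewrite (eq_bigr _ (edges_insideE B)) exchange_big -sum_r_subsets_cst.
  apply: eq_bigr => S /andP[_ /eqP /cP <-]; rewrite -sum_matchings_codegree.
  by apply: eq_bigr => M _; rewrite andbb.
have := sumE [set: 'I_N]%SET; rewrite (eq_bigr _ edges_inside_setT).
rewrite sum_nat_const cardsT card_ord sumE [n * _]mulnC => ->.
by rewrite -mulnA; congr (_ * _)%N; exact: mulnC.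
Qed.

Lemma sum_r_subset_pairs_cst (A : {set 'I_N}) (c : nat) :
  \sum_(S : {set 'I_N} | (S \subset A) && (#|S| == r))
   \sum_(S' : {set 'I_N} | (S' \subset A :\: S)%SET && (#|S'| == r)) c =
  'C(#|A|, r) * 'C(#|A| - r, r) * c.
Proof.
rewrite -mulnA -sum_r_subsets_cst; apply: eq_bigr => S /andP[SA /eqP Sr].
by rewrite sum_r_subsets_cst cardsD (finset.setIidPr SA) Sr.
Qed.

(** The proportion of r-sets that avoid a given r-set grows with the ground set. For falling
    factorials this holds factor by factor: (k-r-i)(m-i) <= (k-i)(m-r-i). *)
Lemma mul_bin_sub_le (k m : nat) : k <= m ->
  'C(k - r, r) * 'C(m, r) <= 'C(k, r) * 'C(m - r, r).
Proof.
move=> km; rewrite -(leq_pmul2r (fact_gt0 r)) -(leq_pmul2r (fact_gt0 r)).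
have -> : 'C(k - r, r) * 'C(m, r) * r`! * r`! = (k - r) ^_ r * m ^_ r.
  by rewrite -!bin_ffact; lia.
have -> : 'C(k, r) * 'C(m - r, r) * r`! * r`! = k ^_ r * (m - r) ^_ r.
  by rewrite -!bin_ffact; lia.
rewrite !ffact_prod -!big_split/=; apply: leq_prod => i _.
(* A truncated factor makes the left side vanish. Otherwise the claim becomes a(a+r+b) <=
   (a+r)(a+b), where the two sides differ by rb. *)
have [kri|kri] := leqP (k - r) i.
  by rewrite (_ : k - r - i = 0)%N ?mul0n//; lia.
have [a ak] : exists a, k = a + r + i by exists (k - r - i)%N; lia.
have [b bm] : exists b, m = k + b by exists (m - k)%N; lia.
by rewrite bm ak; nia.
Qed.

(** The full set again determines the constant [c]. Then [mul_bin_sub_le] replaces the ratio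
    C(k-r,r) / C(N-r,r) by the larger C(k,r) / C(N,r), where k is the size of [A]. *)
Lemma sum_edges_inside_pairs (A : {set 'I_N}) :
  (\sum_(M in RM) edges_inside A M * (edges_inside A M).-1) * 'C(N, r) ^ 2 <=
  'C(#|A|, r) ^ 2 * (n * n.-1 * #|RM|).
Proof.
have [c cP] : exists c, forall S S' : {set 'I_N},
    #|S| = r -> #|S'| = r -> [disjoint S & S'] -> codegree S S' = c.
  case: (pickP [pred S : {set 'I_N} * {set 'I_N} |
      [&& #|S.1| == r, #|S.2| == r & [disjoint S.1 & S.2]]]) => [U|no].
    move=> /and3P[/eqP U1 /eqP U2 dU]; exists (codegree U.1 U.2) => S S' Sr S'r d.
    by apply: codegree_disjoint; rewrite ?U1 ?U2.
  by exists 0 => S S' Sr S'r d; have /= := no (S, S'); rewrite Sr S'r !eqxx d.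
have sumE B : \sum_(M in RM) edges_inside B M * (edges_inside B M).-1 =
    'C(#|B|, r) * 'C(#|B| - r, r) * c.
  rewrite (eq_bigr _ (edges_inside_pairsE B)) exchange_big/=.
  rewrite -sum_r_subset_pairs_cst; apply: eq_bigr => S /andP[_ /eqP Sr].
  rewrite exchange_big/=; apply: eq_bigr => S' /andP[].
  rewrite subsetD => /andP[_ d] /eqP S'r.
  by rewrite sum_matchings_codegree cP// disjoint_sym.
have := sumE [set: 'I_N]%SET.
rewrite (eq_bigr (fun=> n * n.-1)); last first.
  by move=> M MRM; rewrite edges_inside_setT.
rewrite sum_nat_const cardsT card_ord sumE [n * _ * _]mulnC => ->.
have := mul_bin_sub_le (max_card A); rewrite card_ord => le.
have -> : 'C(#|A|, r) * 'C(#|A| - r, r) * c * 'C(N, r) ^ 2 =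
  'C(#|A|, r) * 'C(N, r) * c * ('C(#|A| - r, r) * 'C(N, r)) by lia.
have -> : 'C(#|A|, r) ^ 2 * ('C(N, r) * 'C(N - r, r) * c) =
  'C(#|A|, r) * 'C(N, r) * c * ('C(#|A|, r) * 'C(N - r, r)) by lia.
by rewrite leq_mul2l le orbT.
Qed.

End Matchings.

(** * Edge lengths in terms of initial segments *)

Lemma sum_ord_geq (N m : nat) : \sum_(k < N) (m <= k) = N - m.
Proof.
elim: N => [|N IH]; first by rewrite big_ord0.
by rewrite big_ord_recr/= IH; case: (leqP m N) => /=; lia.
Qed.

Lemma sum_ord_lt (N m : nat) : \sum_(k < N) (k < m) = minn N m.
Proof.
elim: N => [|N IH]; first by rewrite big_ord0 min0n.
by rewrite big_ord_recr/= IH; case: (ltnP N m) => /=; lia.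
Qed.

Definition initial_segment (N k : nat) : {set 'I_N} :=
  [set i : 'I_N | i < k]%SET.

Lemma card_initial_segment (N k : nat) : k <= N -> #|initial_segment N k| = k.
Proof.
move=> kN; rewrite -sum1_card big_mkcond -[RHS](minn_idPr kN) -sum_ord_lt.
by apply: eq_bigr => i _; rewrite inE; case: ifP.
Qed.

(** The length is |e| max(e) - sum(e), and the k < N with e inside [k] are those from max(e) on, N -
    max(e) in number. The additive form avoids truncated subtraction. *)
Lemma edge_length_complement (N : nat) (e : {set 'I_N}) : 0 < #|e| ->
  edge_length e + \sum_(i in e) i.+1
    + #|e| * \sum_(k < N) (e \subset initial_segment N k) = #|e| * N.
Proof.
move=> e0; set s := edge_points e; set m := nth 0 s #|e|.-1.
have ms (i : 'I_N) : i \in e -> i.+1 \in s.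
  by move=> ie; rewrite mem_sort; apply/mapP; exists i; rewrite ?mem_enum.
have sz : size s = #|e| := size_edge_points e.
have le_m j : j < #|e| -> nth 0 s j <= m.
  move=> je; rewrite /m; have := edge_points_sorted e; rewrite -/s => ss.
  apply: (sorted_leq_nth leq_trans leqnn 0); rewrite ?inE ?sz//; try lia.
  exact: sub_sorted ltnW _ ss.
have m_mem : exists2 i : 'I_N, i \in e & i.+1 = m.
  have : m \in s by rewrite mem_nth// sz; lia.
  by rewrite mem_sort => /mapP[i]; rewrite mem_enum => ie ->; exists i.
have sumE : \sum_(i in e) i.+1 = \sum_(0 <= j < #|e|) nth 0 s j.
  rewrite -sz -(big_nth 0 xpredT id) (perm_big _ (permEl (perm_sort _ _)))/=.
  by rewrite big_map big_enum.
have below : \sum_(k < N) (e \subset initial_segment N k) = N - m.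
  rewrite -[RHS]sum_ord_geq; apply: eq_bigr => k _; congr nat_of_bool.
  apply/fintype.subsetP/idP => [sub|mk i ie].
    by have [i ie <-] := m_mem; have := sub _ ie; rewrite inE.
  have /(nthP 0)[j] := ms _ ie; rewrite sz => /le_m jm ij.
  by rewrite inE -ij (leq_trans jm mk).
rewrite edge_lengthE sumE below -/s -/m.
have mN : m <= N by case: m_mem => i _ <-.
suff -> : \sum_(0 <= j < #|e|.-1) (m - nth 0 s j)
    + \sum_(0 <= j < #|e|) nth 0 s j = #|e| * m.
  by rewrite -mulnDr subnKC.
(* The last point is [m] itself; each other point s_j is paired with m - s_j. *)
rewrite -{2}(prednK e0) big_nat_recr//= addnA -big_split/=.
rewrite (eq_big_nat _ _ (F2 := fun=> m)); last first.
  move=> j /andP[_ jm]; rewrite subnK//; apply: le_m.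
  by move: jm e0; case: #|e|; lia.
by rewrite sum_nat_const_nat subn0 -[in RHS](prednK e0) mulSn addnC.
Qed.

Section TotalLength.
Variables r n : nat.
Local Notation N := (r * n)%N.
Local Notation RM := (r_matchings r n).

Definition edges_below_sum (M : {set {set 'I_N}}) : nat :=
  \sum_(k < N) edges_inside (initial_segment N k) M.

(** The identity for one edge is summed over [M]; each point is counted once because [M] is a
    partition. *)
Lemma total_length_complement (M : {set {set 'I_N}}) : 0 < r -> M \in RM ->
  total_length M + \sum_(i < N) i.+1 + r * edges_below_sum M = N * N.
Proof.
move=> r0 MRM; have card_e := r_matchings_card_edge MRM.
have sum1 : \sum_(i < N) i.+1 = \sum_(e in M) \sum_(i in e) i.+1.
  have := MRM; rewrite inE => /and3P[pM _ _].
  by rewrite -(finset.set_partition_big M pM); apply: eq_bigl => i; rewrite inE.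
have sum2 : edges_below_sum M =
    \sum_(e in M) \sum_(k < N) (e \subset initial_segment N k).
  rewrite exchange_big; apply: eq_bigr => k _.
  rewrite /edges_inside -sum1_card big_mkcond [RHS]big_mkcond/=.
  by apply: eq_bigr => e _; rewrite inE; case: (e \in M) => //=; case: ifP.
rewrite sum1 sum2 big_distrr -!big_split/= (eq_bigr (fun=> r * N)).
  have := MRM; rewrite inE => /and3P[_ /eqP Mn _].
  by rewrite sum_nat_const Mn; lia.
move=> e eM; have := @edge_length_complement _ e.
by rewrite (card_e _ eM); apply.
Qed.

End TotalLength.

(** * Summation formulas and the Cauchy-Schwarz inequality *)

Lemma sum_ord_succ (N : nat) : 2 * \sum_(i < N) i.+1 = N * N.+1.
Proof.
by elim: N => [|N IH]; rewrite ?big_ord0// big_ord_recr/= mulnDr IH; lia.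
Qed.

Lemma sum_bin_column (N r : nat) : \sum_(k < N) 'C(k, r) = 'C(N, r.+1).
Proof. by elim: N => [|N IH]; rewrite ?big_ord0// big_ord_recr/= IH binS. Qed.

Local Open Scope ring_scope.

(** Cauchy-Schwarz against the constant vector: the sum of the squares (N a_i - S)^2 equals N (N T -
    S^2). *)
Lemma sqr_sum_le (R : realFieldType) (N : nat) (a : 'I_N -> R) :
  (\sum_(i < N) a i) ^+ 2 <= N%:R * \sum_(i < N) a i ^+ 2.
Proof.
case: N a => [|N] a; first by rewrite !big_ord0 expr2 mulr0.
set S := \sum_(i < _) a i; set T := \sum_(i < _) a i ^+ 2; set m : R := N.+1%:R.
have m0 : 0 < m by rewrite ltr0n.
have : 0 <= \sum_(i < N.+1) (m * a i - S) ^+ 2.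
  by apply: sumr_ge0 => i _; exact: sqr_ge0.
have E i : (m * a i - S) ^+ 2 =
  m ^+ 2 * a i ^+ 2 - 2 * m * S * a i + S ^+ 2 by ring.
rewrite (eq_bigr _ (fun i _ => E i)) !big_split/= sumrN -!mulr_sumr -/S -/T.
rewrite sumr_const card_ord -[_ *+ N.+1]mulr_natr -/m => ge0.
rewrite -subr_ge0 -(pmulr_rge0 _ m0); apply: le_trans ge0 _.
by rewrite le_eqVlt; apply/predU1P; left; ring.
Qed.

(** * First and second moments of the counts X_k and of their sum *)

Section Moments.
Variables (R : realFieldType) (r n : nat).
Hypothesis n0 : (0 < n)%N.
Local Notation N := (r * n)%N.
Local Notation RM := (r_matchings r n).
Local Notation X k M := ((edges_inside (initial_segment N k) M)%:R : R).
Local Notation q k := ('C(k, r)%:R / 'C(N, r)%:R : R).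
Local Notation Z := (#|RM|%:R : R).

Lemma binN_neq0 : 'C(N, r)%:R != 0 :> R.
Proof. by rewrite pnatr_eq0 -lt0n bin_gt0 leq_pmulr. Qed.

Lemma mean_edges_below (k : nat) : (k <= N)%N ->
  \sum_(M in RM) X k M = n%:R * q k * Z.
Proof.
move=> kN; rewrite -natr_sum; apply: (mulIf binN_neq0).
rewrite -natrM sum_edges_inside card_initial_segment// !natrM.
by field; exact: binN_neq0.
Qed.

Lemma factorial_moment_edges_below (k : nat) : (k <= N)%N ->
  \sum_(M in RM) X k M * (X k M - 1) <= n%:R * (n%:R - 1) * (q k) ^+ 2 * Z.
Proof.
move=> kN; have C0 : 0 < 'C(N, r)%:R :> R by rewrite lt_def binN_neq0 ler0n.
(* At [m = 0] the predecessor is truncated, but both products vanish. *)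
have predE m : m%:R * (m%:R - 1) = (m * m.-1)%:R :> R.
  by case: m => [|m]; rewrite ?mul0r// -[in m.+1%:R - 1]natr1 addrK -natrM.
rewrite (eq_bigr (fun M => ((edges_inside (initial_segment N k) M *
  (edges_inside (initial_segment N k) M).-1)%N%:R : R))); last by move=> M _.
rewrite predE -natr_sum -(ler_pM2r (exprn_gt0 2 C0)).
have -> : (n * n.-1)%:R * q k ^+ 2 * Z * 'C(N, r)%:R ^+ 2 =
    ('C(k, r) ^ 2 * (n * n.-1 * #|RM|))%:R.
  by rewrite [RHS]natrM natrX [(_ * #|_|)%:R]natrM; field; exact: binN_neq0.
rewrite -natrX -natrM ler_nat.
have := sum_edges_inside_pairs (initial_segment N k).
by rewrite card_initial_segment.
Qed.

(** After division by [Z], E X(X-1) + E X - (E X)^2 is at most n(n-1)q^2 + nq - n^2 q^2 = n(q -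
    q^2). *)
Lemma variance_edges_below (k : nat) : (k <= N)%N ->
  \sum_(M in RM) (X k M - n%:R * q k) ^+ 2 <= n%:R * Z.
Proof.
move=> kN; have := factorial_moment_edges_below kN.
have E M : (X k M - n%:R * q k) ^+ 2 = X k M * (X k M - 1)
    + (1 - 2 * n%:R * q k) * X k M + (n%:R * q k) ^+ 2 by ring.
rewrite (eq_bigr _ (fun M _ => E M)) !big_split/= -mulr_sumr mean_edges_below//.
rewrite sumr_const -[_ *+ #|_|]mulr_natr.
set Y := \sum_(M in _) _ => Yle.
have nZ : 0 <= n%:R * Z by rewrite mulr_ge0 ?ler0n.
suff : n%:R * Z * (q k - q k ^+ 2) <= n%:R * Z by nra.
rewrite ler_piMr//.
(* This square gives q - q^2 <= 1/4. *)
have := sqr_ge0 (q k - 1 / 2).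
nra.
Qed.

Local Notation Y M := ((edges_below_sum M)%:R : R).
Local Notation mY := (n%:R * (r%:R * n%:R - r%:R) / (r%:R + 1) : R).

(** The hockey-stick identity sums the numerators to C(N,r+1), and (r+1) C(N,r+1) = (N-r) C(N,r). *)
Lemma sum_bin_ratio : \sum_(k < N) q k = (r%:R * n%:R - r%:R) / (r%:R + 1).
Proof.
rewrite -mulr_suml -natr_sum sum_bin_column.
have r1 : r%:R + 1 != 0 :> R by rewrite natr1 pnatr_eq0.
have := mul_bin_left N r; move=> /(congr1 (fun x => x%:R : R)).
rewrite !natrM natrB ?leq_pmulr// natrM -natr1 => E.
by apply: (mulfI r1); rewrite mulrA E; field; rewrite binN_neq0 r1.
Qed.

Lemma mean_edges_below_sum : \sum_(M in RM) Y M = mY * Z.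
Proof.
under eq_bigr do rewrite natr_sum; rewrite exchange_big/=.
rewrite (eq_bigr (fun k : 'I_N => n%:R * q k * Z)); last first.
  by move=> k _; rewrite mean_edges_below// ltnW.
by rewrite -mulr_suml -mulr_sumr sum_bin_ratio mulrA.
Qed.

(** Cauchy-Schwarz over k reduces the variance of the sum to the individual variances, so no
    covariance of two different X_k has to be computed. *)
Lemma variance_edges_below_sum :
  \sum_(M in RM) (Y M - mY) ^+ 2 <= N%:R ^+ 2 * (n%:R * Z).
Proof.
have YE M : Y M - mY = \sum_(k < N) (X k M - n%:R * q k).
  by rewrite sumrB -mulr_sumr sum_bin_ratio natr_sum mulrA.
apply: (@le_trans _ _
  (\sum_(M in RM) N%:R * \sum_(k < N) (X k M - n%:R * q k) ^+ 2)).
  by apply: ler_sum => M _; rewrite YE sqr_sum_le.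
rewrite -mulr_sumr exchange_big/= expr2 -mulrA ler_wpM2l ?ler0n//.
apply: (@le_trans _ _ (\sum_(k < N) n%:R * Z)).
  by apply: ler_sum => k _; rewrite variance_edges_below// ltnW.
by rewrite sumr_const card_ord -[_ *+ N]mulr_natl.
Qed.

End Moments.

(** * Mean and second moment of the mean length *)

Section MeanLength.
Variables (R : realType) (r n : nat).
Hypotheses (r0 : (0 < r)%N) (n0 : (0 < n)%N).
Local Notation RM := (r_matchings r n).
Local Notation mu :=
  ((r%:R * (r%:R - 1) * (r%:R * n%:R + 1)) / (2 * (r%:R + 1)) : R).
Local Notation L M := (mean_length R M).

(** The mean length is an affine function, of slope -r/n, of the sum of the X_k, and [mu] is its
    value at the mean of that sum. *)
Lemma mean_length_deviation (M : {set {set 'I_(r * n)}}) : M \in RM ->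
  L M - mu = - (r%:R / n%:R) *
    ((edges_below_sum M)%:R - n%:R * (r%:R * n%:R - r%:R) / (r%:R + 1)).
Proof.
move=> MRM.
have r1 : r%:R + 1 != 0 :> R by rewrite natr1 pnatr_eq0.
have n1 : n%:R != 0 :> R by rewrite pnatr_eq0 -lt0n.
have := congr1 (fun x => x%:R : R) (total_length_complement r0 MRM).
have := congr1 (fun x => x%:R : R) (sum_ord_succ (r * n)).
rewrite !natrD !natrM -natr1 natrM => E1 E2.
have E : (total_length M)%:R = r%:R * n%:R * (r%:R * n%:R)
   - r%:R * n%:R * (r%:R * n%:R + 1) / 2 - r%:R * (edges_below_sum M)%:R :> R.
  by lra.
by rewrite /mean_length E; field; rewrite n1 r1.
Qed.

Lemma expected_mean_length : \sum_(M in RM) L M = mu * #|RM|%:R.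
Proof.
apply/eqP; rewrite -subr_eq0 mulr_natr -sumr_const -sumrB.
rewrite (eq_bigr _ mean_length_deviation) -mulr_sumr sumrB.
by rewrite (mean_edges_below_sum R r n0) sumr_const mulr_natr subrr mulr0.
Qed.

Lemma variance_mean_length :
  \sum_(M in RM) (L M - mu) ^+ 2 <= r%:R ^+ 4 * n%:R * #|RM|%:R.
Proof.
have n1 : n%:R != 0 :> R by rewrite pnatr_eq0 -lt0n.
rewrite (eq_bigr _
  (fun M h => congr1 (fun x => x ^+ 2) (mean_length_deviation h))).
under eq_bigr do rewrite exprMn; rewrite -mulr_sumr.
have := variance_edges_below_sum R r n0.
rewrite -(ler_pM2l (_ : 0 < (- (r%:R / n%:R)) ^+ 2)).
  move=> /le_trans; apply.
  (* The constant is (r/n)^2 (rn)^2 n = r^4 n. *)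
  by rewrite natrM le_eqVlt; apply/predU1P; left; field.
by rewrite exprn_even_gt0//= oppr_eq0 mulf_neq0 ?invr_eq0// pnatr_eq0 -lt0n.
Qed.

(** The new centre differs from [mu] by d = r(r-1) / (2(r+1)) <= r, so d^2 <= r^4 n. With (a+d)^2 <=
    2a^2 + 2d^2 the bound becomes 4 r^4 n. *)
Lemma mean_length_second_moment :
  \sum_(M in RM) (L M - (r%:R - 1) * r%:R ^+ 2 * n%:R / (2 * (r%:R + 1))) ^+ 2
    <= 4 * r%:R ^+ 4 * n%:R * #|RM|%:R.
Proof.
have r1 : r%:R + 1 != 0 :> R by rewrite natr1 pnatr_eq0.
have rge : 1 <= r%:R :> R by rewrite ler1n.
have nge : 1 <= n%:R :> R by rewrite ler1n.
set c := _ / _; set d : R := mu - c.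
have dE : d * (2 * (r%:R + 1)) = r%:R * (r%:R - 1) by rewrite /d /c; field.
have d2 : d ^+ 2 <= r%:R ^+ 4 * n%:R.
  move: (r%:R : R) rge dE {r1} => x x1 dE.
  have d0 : 0 <= d by nra.
  have dx : d <= x by nra.
  have : x ^+ 2 <= x ^+ 4 * n%:R.
    by rewrite (exprD x 2 2) -mulrA ler_peMr ?sqr_ge0//; nra.
  by apply: le_trans; rewrite ler_sqr ?nnegrE//; lra.
apply: (@le_trans _ _
  (\sum_(M in RM) (2 * (L M - mu) ^+ 2 + 2 * (r%:R ^+ 4 * n%:R)))).
  apply: ler_sum => M _; have := sqr_ge0 (L M - mu - d).
  have -> : L M - c = L M - mu + d by rewrite /d; ring.
  by set x := L M - mu; nra.
rewrite big_split/= -mulr_sumr sumr_const -[_ *+ #|_|]mulr_natr.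
have := variance_mean_length; lra.
Qed.

End MeanLength.

Local Open Scope classical_set_scope.
Local Open Scope ring_scope.

(** * Transfer from counting to a random matching on a probability space *)

Section UniformMatching.
Variables (R : realType) (r n : nat) (d : measure_display) (T : measurableType d).
Variables (P : probability T R) (M : T -> {set {set 'I_(r * n)}}).
Hypothesis hM : uniform_r_matching P M.
Local Notation RM := (r_matchings r n).

(** The event is a union of fibres of [M], which are finitely many and measurable by hypothesis. *)
Lemma measurable_uniform_r_matching (Q : set {set {set 'I_(r * n)}}) :
  measurable [set t | Q (M t)].
Proof.
rewrite (_ : [set t | _] = \bigcup_(A in Q) [set t | M t = A]).
  by apply: fin_bigcup_measurable => [|A _]; [exact: finite_finset|case: (hM A)].
by apply/seteqP; split => [t Qt|t [A QA /= ->]//]; exists (M t).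
Qed.

(** The integrand is a finite combination of indicators of the fibres of [M]; fibres over
    non-matchings have probability 0. *)
Lemma integral_uniform_r_matching (g : {set {set 'I_(r * n)}} -> R) :
  (\int[P]_t (g (M t))%:E = ((\sum_(A in RM) g A) / #|RM|%:R)%:E)%E.
Proof.
have mM A : measurable [set t | M t = A] by case: (hM A).
have E t : (g (M t))%:E = (\sum_A (g A)%:E * (\1_[set t | M t = A] t)%:E)%E.
  rewrite (bigD1 (M t))//= big1 ?adde0; last first.
    move=> A neq; rewrite indicE memNset ?mule0//= => /esym/eqP.
    by rewrite (negbTE neq).
  by rewrite indicE mem_set// mule1.
under eq_integral do rewrite E.
rewrite integral_sum//; last first.
  by move=> A; apply: integrableZl => //; exact: integrable_indic.
transitivity (\sum_A (if A \in RM then g A / #|RM|%:R else 0)%:E)%E.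
  apply: eq_bigr => A _; rewrite integralZl//; last exact: integrable_indic.
  rewrite integral_indic// setIT [X in (_ * X)%E](hM A).2.
  by case: ifP => _; rewrite -EFinM ?mulr0.
by rewrite sumEFin -big_mkcond mulr_suml.
Qed.

(* The junk value 1 / 0 = 0 would give the law of M total mass 0. *)
Lemma card_r_matchings_gt0 : (0 < #|RM|)%N.
Proof.
rewrite lt0n; apply/eqP => RM0; have := integral_uniform_r_matching (fun=> 1).
rewrite RM0 invr0 mulr0 integral_cst// [X in (_ * X)%E]probability_setT mul1e.
by move=> /eqP; rewrite eqe oner_eq0.
Qed.

Lemma probability_uniform_r_matching (Q : pred {set {set 'I_(r * n)}}) :
  P [set t | Q (M t)] = ((\sum_(A in RM) (Q A)%:R) / #|RM|%:R)%:E.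
Proof.
rewrite -(integral_uniform_r_matching (fun A => (Q A)%:R)).
rewrite -[[set t | Q (M t)]]setIT -integral_indic//.
  apply: eq_integral => t _; rewrite indicE; congr (_%:R)%:E.
  by congr nat_of_bool; apply/asboolP/idP.
exact: (measurable_uniform_r_matching [set A | Q A]).
Qed.

(** The indicator of |g - c| <= t is at least 1 - (g-c)^2 / t^2 pointwise; averaging over the
    matchings gives Chebyshev's bound around any centre [c]. *)
Lemma chebyshev_uniform_r_matching (g : {set {set 'I_(r * n)}} -> R) (c v t : R) :
  0 < t ->
  \sum_(A in RM) (g A - c) ^+ 2 <= v * #|RM|%:R ->
  ((1 - v / t ^+ 2)%:E <= P [set x | (`|g (M x) - c| <= t)%R])%E.
Proof.
move=> t0 gv; have Z0 : 0 < #|RM|%:R :> R by rewrite ltr0n card_r_matchings_gt0.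
rewrite (probability_uniform_r_matching (fun A => `|g A - c| <= t)) lee_fin.
have t2 : 0 < t ^+ 2 by rewrite exprn_gt0.
rewrite ler_pdivlMr//.
apply: (@le_trans _ _ (\sum_(A in RM) (1 - (g A - c) ^+ 2 / t ^+ 2))).
  rewrite sumrB sumr_const -mulr_suml mulrBl mul1r lerB// mulrAC.
  by rewrite ler_pM2r ?invr_gt0.
apply: ler_sum => A _; case: (lerP `|g A - c| t) => gA /=.
  by rewrite mulr1n gerBl divr_ge0 ?sqr_ge0// ltW.
rewrite mulr0n subr_le0 ler_pdivlMr// mul1r -(real_normK (num_real (g A - c))).
by rewrite ler_sqr ?nnegrE ?normr_ge0// ltW.
Qed.

End UniformMatching.

Theorem corollary1p2 (R : realType) (r : nat) (hr : (2 <= r)%N)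
    (d : nat -> measure_display) (T : forall n : nat, measurableType (d n))
    (P : forall n : nat, probability (T n) R)
    (M : forall n : nat, T n -> {set {set 'I_(r * n)}})
    (hM : forall n : nat, (1 <= n)%N -> uniform_r_matching (P n) (M n)) :
  (forall n : nat, (1 <= n)%N ->
     ('E_(P n)[fun t => mean_length R (M n t)]
      = ((r%:R * (r%:R - 1) * (r%:R * n%:R + 1)) / (2 * (r%:R + 1)))%:E)%E) /\
  (forall omega : nat -> R,
     omega n @[n --> \oo] --> +oo ->
     P n [set t | `|mean_length R (M n t)
                    - ((r%:R - 1) * r%:R ^+ 2 * n%:R) / (2 * (r%:R + 1))|
                  <= omega n * Num.sqrt n%:R] @[n --> \oo] --> 1%E).
Proof.
have r0 : (0 < r)%N by exact: ltnW.
split=> [n n0|omega womega].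
  have Z0 : #|r_matchings r n|%:R != 0 :> R.
    by rewrite pnatr_eq0 -lt0n (card_r_matchings_gt0 (hM n n0)).
  rewrite unlock (integral_uniform_r_matching (hM n n0) (@mean_length R r n)).
  by rewrite (expected_mean_length R r0 n0) mulfK.
(* Chebyshev's bound with t = omega(n) sqrt(n) and v = 4 r^4 n, where n cancels. It applies only
   eventually, once n and omega(n) are positive. *)
pose low n : R := 1 - 4 * r%:R ^+ 4 / omega n ^+ 2.
apply: (@squeeze_cvge _ _ _ _ (fun n => (low n)%:E) _ (fun=> 1%E)).
- near=> n.
  have n0 : (0 < n)%N by near: n; exact: nbhs_infty_gt.
  have w0 : 0 < omega n by near: n; exact: (cvgryPgt _).1.
  rewrite probability_le1 ?andbT; last first.
    exact: (measurable_uniform_r_matching (hM n n0)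
      [set A | `|mean_length R A - _| <= _]).
  have s0 : 0 < Num.sqrt n%:R :> R by rewrite sqrtr_gt0 ltr0n.
  have := chebyshev_uniform_r_matching (hM n n0) (mulr_gt0 w0 s0)
    (mean_length_second_moment R r0 n0).
  apply: le_trans; rewrite lee_fin /low exprMn sqr_sqrtr ?ler0n//.
  rewrite le_eqVlt; apply/predU1P; left; congr (_ - _); field.
  by rewrite !gt_eqF ?ltr0n.
- apply: cvg_EFin; first exact: nearW.
  rewrite -[X in _ --> X]subr0 /low; apply: cvgB; first exact: cvg_cst.
  rewrite -(mulr0 (4 * r%:R ^+ 4)); apply: cvgM; first exact: cvg_cst.
  have winv : (fun n => (omega n)^-1) n @[n --> \oo] --> (0 : R).
    by apply/gtr0_cvgV0 => //; exact: (cvgryPgt _).1.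
  rewrite -(mulr0 0); under eq_fun do rewrite expr2 invfM.
  exact: cvgM.
- exact: cvg_cst.
Unshelve. all: by end_near.
Qed.
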